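(* Let $\mathbb K$ be a field of characteristic $0$. The primitive subspace of the bialgebra $G_{\mathcal C}/I_{\mathcal C}$, i.e. the subspace of elements $p$ with $\Delta(p)=p\otimes 1+1\otimes p$, is generated as a $\mathbb K$-vector space by the classes of the connected framed graphs with all edges colored red.
   Context: A framed graph is an isomorphism class of finite simple graphs $\Gamma$ equipped with a framing $f\colon V(\Gamma)\to\mathbb F_2$ (isomorphisms preserve framings). A colored framed graph is, up to isomorphism preserving framing and coloring, a framed graph with a coloring $E(\Gamma)\to\{b,r\}$ of its edges; edges of color $b$ are called black and edges of color $r$ are called red. The empty graph is not considered connected; a single vertex is connected. $G_{\mathcal C}$ is the graded bialgebra over $\mathbb K$ with basis the colored framed graphs, graded by the number of vertices. The product is the bilinear extension of disjoint union, the unit is the empty graph, the counit sends the empty graph to $1$ and all other graphs to $0$, and the coproduct is $\Delta_{\mathcal C}(\Gamma)=\sum\Gamma_p\otimes\Gamma_q$, where the sum is over all ordered splittings $V(\Gamma)=p\sqcup q$ (parts possibly empty) such that no vertex of $p$ is connected to a vertex of $q$ by a red edge, and $\Gamma_p,\Gamma_q$ are the induced subgraphs with inherited framing and edge coloring. $I_{\mathcal C}\subset G_{\mathcal C}$ is the ideal spanned by all elements $\Gamma_{r}-\Gamma_{b}+\Gamma_{\varnothing}$, where $\Gamma_r$ is a colored framed graph with a chosen red edge, $\Gamma_b$ is obtained from it by recoloring the chosen edge black, and $\Gamma_\varnothing$ is obtained by deleting the chosen edge (everything else, including the colors of all other edges, is unchanged). It is a biideal, so $G_{\mathcal C}/I_{\mathcal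 C}$ carries the induced bialgebra structure. *)

(* Defs.v *)
From HB Require Import structures.
From mathcomp Require Import all_boot all_algebra generic_quotient ring_quotient.
From mathcomp Require Import boolp finmap monalg.

Set Implicit Arguments.
Unset Strict Implicit.
Unset Printing Implicit Defensive.

Import GRing.Theory.

Local Open Scope ring_scope.
Local Open Scope quotient_scope.

Section Span.
Variables (K : fieldType) (V : lmodType K).
Implicit Types (S : V -> Prop) (v w : V).

Definition in_lspan S v : Prop :=
  exists n (a : 'I_n -> K) (u : 'I_n -> V),
    (forall i, S (u i)) /\ v = \sum_i a i *: u i.

Definition lspan S : {pred V} := fun v => `[< in_lspan S v >].

Lemma lspan_submod S : submod_closed (lspan S).
Proof.
split.
  apply/asboolP; exists 0%N, (fun=> 0), (fun=> 0).
  by split=> [[]|] //; rewrite big_ord0.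
move=> c v w /asboolP [m [a [u [Su ->]]]] /asboolP [n [b [t [St ->]]]].
apply/asboolP; exists (m + n)%N.
exists (fun i => match split i with inl j => c * a j | inr j => b j end).
exists (fun i => match split i with inl j => u j | inr j => t j end).
split=> [i|]; first by case: split.
rewrite big_split_ord scaler_sumr; congr (_ + _); apply: eq_bigr => i _ /=.
  by rewrite -[lshift _ _]/(unsplit (inl i)) unsplitK scalerA.
by rewrite -[rshift _ _]/(unsplit (inr i)) unsplitK.
Qed.

HB.instance Definition _ S :=
  GRing.isSubmodClosed.Build K V (lspan S) (lspan_submod S).

Lemma mem_lspan S v : S v -> v \in lspan S.
Proof.
move=> Sv; apply/asboolP; exists 1%N, (fun=> 1), (fun=> v).
by rewrite big_ord1 scale1r.
Qed.

Lemma lspan_sub S (T : submodClosed V) :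
  (forall v, S v -> v \in T) -> {subset lspan S <= T}.
Proof.
move=> ST v /asboolP [n [a [u [Su ->]]]].
by apply: rpred_sum => i _; apply: rpredZ; apply: ST.
Qed.

Lemma lspan_ind S (P : V -> Prop) :
  P 0 -> (forall a v w, S v -> P w -> P (a *: v + w)) ->
  forall v, v \in lspan S -> P v.
Proof.
move=> P0 PS v /asboolP [n [a [u [Su ->]]]].
by elim/big_rec: _ => // i w _; apply: PS.
Qed.

End Span.

Section LmodQuotient.
Variables (K : fieldType) (V : lmodType K) (S : V -> Prop).

Local Notation Q := (Quotient.quot (lspan S)).

Definition quot_scale (a : K) : Q -> Q := lift_op1 Q ( *:%R a).

Lemma pi_quot_scale (a : K) : {morph \pi_Q : x / a *: x >-> quot_scale a x}.
Proof.
move=> x; unlock quot_scale; apply/eqP; rewrite -Quotient.idealrBE.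
by rewrite -scalerBr rpredZ // Quotient.idealrBE reprK.
Qed.

Lemma quot_scaleA a b (x : Q) :
  quot_scale a (quot_scale b x) = quot_scale (a * b) x.
Proof. by rewrite -[x]reprK -!pi_quot_scale scalerA. Qed.

Lemma quot_scale1 : left_id 1 quot_scale.
Proof. by move=> x; rewrite -[x]reprK -!pi_quot_scale scale1r. Qed.

Lemma quot_scaleDr : right_distributive quot_scale +%R.
Proof.
move=> a x y; rewrite -[x]reprK -[y]reprK -!(rmorphD, raddfD) -!pi_quot_scale.
by rewrite -raddfD scalerDr.
Qed.

Lemma quot_scaleDl (x : Q) : {morph quot_scale^~ x : a b / a + b}.
Proof. by move=> a b; rewrite -[x]reprK -!pi_quot_scale -raddfD scalerDl. Qed.

HB.instance Definition _ := GRing.Zmodule_isLmodule.Build K Q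
  quot_scaleA quot_scale1 quot_scaleDr quot_scaleDl.

Lemma quot_pi_linear : linear (\pi_Q : V -> Q).
Proof. by move=> a x y; rewrite raddfD /= pi_quot_scale. Qed.

End LmodQuotient.

HB.lock Definition linext (K : fieldType) (T : choiceType) (V : lmodType K)
    (h : T -> V) (g : {malg K[T]}) : V :=
  \sum_(k <- msupp g) g@_k *: h k.

Section LinearExtension.
Variables (K : fieldType) (T : choiceType) (V : lmodType K) (h : T -> V).
Local Notation linext := (linext h).

Lemma linextEw (d : {fset T}) g : (msupp g `<=` d)%fset ->
  linext g = \sum_(k <- d) g@_k *: h k.
Proof.
move=> sd; rewrite linext.unlock (big_fset_incl _ sd) // => k _ kg.
by rewrite mcoeff_outdom // scale0r.
Qed.

Lemma linext_is_linear : linear linext.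
Proof.
move=> a x y; pose d := (msupp x `|` msupp y `|` msupp (a *: x + y))%fset.
have sx : (msupp x `<=` d)%fset by rewrite /d -fsetUA fsubsetUl.
have sy : (msupp y `<=` d)%fset by rewrite /d fsetUAC fsubsetUr.
have sz : (msupp (a *: x + y) `<=` d)%fset by rewrite /d fsubsetUr.
rewrite (linextEw sx) (linextEw sy) (linextEw sz) scaler_sumr -big_split /=.
by apply: eq_bigr => k _; rewrite mcoeffD mcoeffZ scalerDl scalerA.
Qed.

HB.instance Definition _ := GRing.isLinear.Build K {malg K[T]} V _
  linext linext_is_linear.

Lemma linextU k : linext << k >> = h k.
Proof. by rewrite linext.unlock msuppU oner_eq0 big_seq_fset1 mcoeffUU scale1r. Qed.

End LinearExtension.

(* The tensor product of two possibly infinite-dimensional spaces: the free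
   space on V * W modulo the span of the bilinearity relations. *)
Section Tensor.
Variables (K : fieldType) (V W : lmodType K).

Inductive bilin_rel : {malg K[(V * W)%type]} -> Prop :=
| BilinL a v v' w :
    bilin_rel (<< (a *: v + v', w) >> - a *: << (v, w) >> - << (v', w) >>)
| BilinR a v w w' :
    bilin_rel (<< (v, a *: w + w') >> - a *: << (v, w) >> - << (v, w') >>).

Definition tensor := Quotient.quot (lspan bilin_rel).

HB.instance Definition _ := GRing.Lmodule.on tensor.

End Tensor.

HB.lock Definition tens (K : fieldType) (V W : lmodType K) (v : V) (w : W) :
  tensor V W := \pi << (v, w) >>.
Section TensorTheory.
Variables (K : fieldType) (V W : lmodType K).

Lemma tensDl a (v v' : V) (w : W) :
  tens (a *: v + v') w = a *: tens v w + tens v' w.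
Proof.
rewrite tens.unlock -quot_pi_linear; apply/eqP.
rewrite -Quotient.idealrBE opprD addrA.
exact/mem_lspan/BilinL.
Qed.

Lemma tensDr a (v : V) (w w' : W) :
  tens v (a *: w + w') = a *: tens v w + tens v w'.
Proof.
rewrite tens.unlock -quot_pi_linear; apply/eqP.
rewrite -Quotient.idealrBE opprD addrA.
exact/mem_lspan/BilinR.
Qed.

Lemma tensDl1 (v v' : V) (w : W) : tens (v + v') w = tens v w + tens v' w.
Proof. by rewrite -[v]scale1r tensDl !scale1r. Qed.

Lemma tensDr1 (v : V) (w w' : W) : tens v (w + w') = tens v w + tens v w'.
Proof. by rewrite -[w]scale1r tensDr !scale1r. Qed.

End TensorTheory.

Section TensorMap.
Variables (K : fieldType) (V W V' W' : lmodType K).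
Variables (f : {linear V -> V'}) (g : {linear W -> W'}).

Definition tensor_map (t : tensor V W) : tensor V' W' :=
  linext (fun p => tens (f p.1) (g p.2)) (repr t).

Lemma tensor_map_pi (x : {malg K[(V * W)%type]}) :
  tensor_map (\pi x) = linext (fun p => tens (f p.1) (g p.2)) x.
Proof.
apply/eqP; rewrite -subr_eq0 -linearB /=; apply/eqP.
have : repr (\pi_(tensor V W) x) - x \in lspan (@bilin_rel K V W).
  by rewrite Quotient.idealrBE reprK.
move: (_ - x) => {x}; apply: lspan_ind => [|a u w Su IH]; first by rewrite linear0.
rewrite linearP /= IH addr0.
rewrite -[RHS](scaler0 _ a); congr (_ *: _).
by case: Su => *; rewrite !linearB linearZ /= !linextU /= linearP
  ?(tensDl, tensDr) -addrA -opprD subrr.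
Qed.

Lemma tensor_map_is_linear : linear tensor_map.
Proof.
move=> a x y; rewrite -[x]reprK -[y]reprK -quot_pi_linear !tensor_map_pi.
exact: linearP.
Qed.

HB.instance Definition _ :=
  GRing.isLinear.Build K (tensor V W) (tensor V' W') _
    tensor_map tensor_map_is_linear.

Lemma tensor_mapE v w : tensor_map (tens v w) = tens (f v) (g w).
Proof. by rewrite [in LHS]tens.unlock tensor_map_pi linextU. Qed.

End TensorMap.

Implicit Types U V W X : finType.

Variant color := black | red.

Definition bool_of_color c := if c is red then true else false.
Definition color_of_bool b := if b then red else black.
Lemma color_of_boolK : cancel bool_of_color color_of_bool.
Proof. by case. Qed.
HB.instance Definition _ := Finite.copy color (can_type color_of_boolK).

(* The second component gives the color of the edge joining two vertices, or
   None when they are not adjacent. *)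
Definition cf_data (V : finType) :=
  ({ffun V -> 'F_2} * {ffun V * V -> option color})%type.

Definition cf_axiom (V : finType) (d : cf_data V) :=
  [forall x, d.2 (x, x) == None]
  && [forall x, forall y, d.2 (x, y) == d.2 (y, x)].

Record cfgraph (V : finType) := CFGraph {
  cf_val : cf_data V;
  cf_valP : cf_axiom cf_val
}.

HB.instance Definition _ V := [isSub for @cf_val V].
HB.instance Definition _ V := [Countable of cfgraph V by <:].

Definition framing V (G : cfgraph V) (x : V) : 'F_2 := (cf_val G).1 x.
Definition edge V (G : cfgraph V) (x y : V) : option color :=
  (cf_val G).2 (x, y).

Lemma edge_irr V (G : cfgraph V) x : edge G x x = None.
Proof. by case/andP: (cf_valP G) => /forallP /(_ x) /eqP. Qed.

Lemma edge_sym V (G : cfgraph V) x y : edge G x y = edge G y x.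
Proof. by case/andP: (cf_valP G) => _ /forallP /(_ x) /forallP /(_ y) /eqP. Qed.

Lemma cfgraph_ext V (G H : cfgraph V) :
  framing G =1 framing H -> edge G =2 edge H -> G = H.
Proof.
move=> eq_f eq_e; apply: val_inj; rewrite /= [LHS]surjective_pairing.
rewrite [RHS]surjective_pairing; congr pair; apply/ffunP; first exact: eq_f.
by case=> x y; exact: eq_e.
Qed.

Lemma mkcfgraph_subproof V (f : V -> 'F_2) (e : V -> V -> option color) :
  (forall x, e x x = None) -> (forall x y, e x y = e y x) ->
  cf_axiom ([ffun x => f x], [ffun p : V * V => e p.1 p.2]).
Proof.
move=> e_irr e_sym.
by apply/andP; split; apply/forallP => x; [|apply/forallP => y];
  rewrite !ffunE /= ?e_irr // e_sym.
Qed.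

HB.lock Definition mkcfgraph (V : finType) (f : V -> 'F_2)
    (e : V -> V -> option color)
    (e_irr : forall x, e x x = None) (e_sym : forall x y, e x y = e y x) :
  cfgraph V := CFGraph (mkcfgraph_subproof f e_irr e_sym).

Section MkGraph.
Variables (V : finType) (f : V -> 'F_2) (e : V -> V -> option color).
Hypotheses (e_irr : forall x, e x x = None) (e_sym : forall x y, e x y = e y x).

Lemma mkcf_framing x : framing (mkcfgraph f e_irr e_sym) x = f x.
Proof. by rewrite mkcfgraph.unlock /framing ffunE. Qed.

Lemma mkcf_edge x y : edge (mkcfgraph f e_irr e_sym) x y = e x y.
Proof. by rewrite mkcfgraph.unlock /edge ffunE. Qed.

End MkGraph.

Section GraphOps.
Variables V W : finType.

Definition cfpull (h : W -> V) (G : cfgraph V) : cfgraph W :=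
  mkcfgraph (fun x => framing G (h x))
    (fun x => edge_irr G (h x)) (fun x y => edge_sym G (h x) (h y)).

Definition sum_framing (G : cfgraph V) (H : cfgraph W) (x : V + W) : 'F_2 :=
  match x with inl a => framing G a | inr b => framing H b end.

Definition sum_edge (G : cfgraph V) (H : cfgraph W) (x y : V + W) :=
  match x, y with
  | inl a, inl a' => edge G a a'
  | inr b, inr b' => edge H b b'
  | _, _ => None
  end.

Lemma sum_edge_irr G H x : sum_edge G H x x = None.
Proof. by case: x => x /=; rewrite edge_irr. Qed.

Lemma sum_edge_sym G H x y : sum_edge G H x y = sum_edge G H y x.
Proof. by case: x y => x [] y //=; rewrite edge_sym. Qed.

Definition cfsum (G : cfgraph V) (H : cfgraph W) : cfgraph (V + W)%type :=
  mkcfgraph (sum_framing G H) (sum_edge_irr G H) (sum_edge_sym G H).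

End GraphOps.

Definition cfiso V W (G : cfgraph V) (H : cfgraph W) : Prop :=
  exists2 h : V -> W, bijective h &
    (forall x, framing H (h x) = framing G x) /\
    (forall x y, edge H (h x) (h y) = edge G x y).

Lemma cfpull_iso V W (h : W -> V) (G : cfgraph V) :
  bijective h -> cfiso (cfpull h G) G.
Proof.
by move=> bij_h; exists h => //; split=> *; rewrite ?mkcf_framing ?mkcf_edge.
Qed.

Definition cfempty : cfgraph 'I_0 :=
  @mkcfgraph _ (fun=> 0) (fun _ _ => None) (fun=> erefl) (fun _ _ => erefl).

Section GraphPredicates.
Variables (V : finType) (G : cfgraph V).

Definition adjacent (x y : V) := edge G x y != None.

Definition cfconnected :=
  (0 < #|V|)%N && [forall x, forall y, connect adjacent x y].

Definition all_red := [forall x, forall y, edge G x y != Some black].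

Definition induced (p : {set V}) : cfgraph {x : V | x \in p} := cfpull val G.

Definition no_red_between (p q : {set V}) :=
  [forall x in p, forall y in q, edge G x y != Some red].

Variables (x y : V) (c : option color).

(* Gives the pair {x, y} the color c, or removes that edge if c is None. *)
Definition set_edge_fun (u v : V) :=
  if (u != v) && ([set u; v] == [set x; y]) then c else edge G u v.

Lemma set_edge_irr u : set_edge_fun u u = None.
Proof. by rewrite /set_edge_fun eqxx edge_irr. Qed.

Lemma set_edge_sym u v : set_edge_fun u v = set_edge_fun v u.
Proof. by rewrite /set_edge_fun eq_sym setUC edge_sym. Qed.

Definition set_edge : cfgraph V :=
  mkcfgraph (framing G) set_edge_irr set_edge_sym.

End GraphPredicates.

Lemma cfiso_refl V (G : cfgraph V) : cfiso G G.
Proof. by exists id => //; exists id. Qed.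

Lemma cfiso_sym V W (G : cfgraph V) (H : cfgraph W) : cfiso G H -> cfiso H G.
Proof.
case=> h [h' hK h'K] [hf he]; exists h'; first by exists h.
by split=> *; rewrite -?hf -?he !h'K.
Qed.

Lemma cfiso_trans V W X (G : cfgraph V) (H : cfgraph W) (I : cfgraph X) :
  cfiso G H -> cfiso H I -> cfiso G I.
Proof.
case=> h bh [hf he] [k bk [kf ke]]; exists (k \o h); first exact: bij_comp.
by split=> *; rewrite /= ?kf ?hf ?ke ?he.
Qed.

Lemma cfiso_sum V V' W W' (G : cfgraph V) (G' : cfgraph V')
    (H : cfgraph W) (H' : cfgraph W') :
  cfiso G G' -> cfiso H H' -> cfiso (cfsum G H) (cfsum G' H').
Proof.
case=> h [h' hK h'K] [hf he] [k [k' kK k'K] [kf ke]].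
exists (fun x => match x with inl a => inl (h a) | inr b => inr (k b) end).
  exists (fun x => match x with inl a => inl (h' a) | inr b => inr (k' b) end);
  by case=> z; congr (_ _).
by split=> [[] z|[] z [] t]; rewrite ?mkcf_framing ?mkcf_edge //=.
Qed.

Lemma cfsumC V W (G : cfgraph V) (H : cfgraph W) :
  cfiso (cfsum G H) (cfsum H G).
Proof.
exists (fun x => match x with inl a => inr a | inr b => inl b end).
  by exists (fun x => match x with inl a => inr a | inr b => inl b end); case.
by split=> [[] z|[] z [] t]; rewrite ?mkcf_framing ?mkcf_edge.
Qed.

Lemma cfsumA U V W (F : cfgraph U) (G : cfgraph V) (H : cfgraph W) :
  cfiso (cfsum F (cfsum G H)) (cfsum (cfsum F G) H).
Proof.
exists (fun x => match x with
  | inl a => inl (inl a) | inr (inl b) => inl (inr b) | inr (inr c) => inr c end).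
  exists (fun x => match x with
  | inl (inl a) => inl a | inl (inr b) => inr (inl b) | inr c => inr (inr c) end);
  by [case=> [?|[]?] | case=> [[]?|?]].
by split=> [[z|[] z]|[z|[] z] [t|[] t]];
  rewrite ?mkcf_framing ?mkcf_edge /= ?mkcf_framing ?mkcf_edge.
Qed.

Lemma ord0F : 'I_0 -> False. Proof. by case. Qed.

Lemma cfsum0 V (G : cfgraph V) : cfiso (cfsum cfempty G) G.
Proof.
exists (fun x => match x with inl a => match ord0F a with end | inr b => b end).
  by exists inr => // -[i|//]; case: (ord0F i).
split=> [[i|z]|[i|z] [j|t]]; rewrite ?mkcf_framing ?mkcf_edge //;
  by [case: (ord0F i)|case: (ord0F j)].
Qed.

(* Every finite graph is isomorphic to one with vertex set some 'I_n, so the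
   isomorphism classes of the latter are all the isomorphism classes. *)
Definition cfrep := {n : nat & cfgraph 'I_n}.

Definition rep_iso (a b : cfrep) : bool := `[< cfiso (tagged a) (tagged b) >].

Lemma rep_iso_equiv : equiv_class_of rep_iso.
Proof.
split=> [a|a b|b a c].
- exact/asboolP/cfiso_refl.
- by apply/asboolP/asboolP; apply: cfiso_sym.
- by move=> /asboolP ab /asboolP bc; apply/asboolP/(cfiso_trans ab).
Qed.

Canonical rep_iso_equivRel := EquivRelPack rep_iso_equiv.

Definition cfclass := {eq_quot rep_iso}.

HB.instance Definition _ := Choice.on cfclass.
HB.instance Definition _ := EqQuotient.on cfclass.

(* Several definitions are locked because conversion would otherwise unfold
   them down to enumerations and finite maps when two graphs differ. *)
HB.lock Definition class_of (V : finType) (G : cfgraph V) : cfclass :=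
  \pi_cfclass (Tagged (fun n => cfgraph 'I_n) (cfpull (@enum_val V predT) G)).

Definition class_rep (c : cfclass) : cfgraph 'I_(tag (repr c)) :=
  tagged (repr c).

Lemma class_ofP V W (G : cfgraph V) (H : cfgraph W) :
  class_of G = class_of H <-> cfiso G H.
Proof.
have isoG := cfpull_iso G (@enum_val_bij V).
have isoH := cfpull_iso H (@enum_val_bij W).
rewrite class_of.unlock; split=> [/eqmodP /asboolP|] isoGH.
  exact: cfiso_trans (cfiso_trans (cfiso_sym isoG) isoGH) isoH.
apply/eqmodP/asboolP => /=.
exact: cfiso_trans isoG (cfiso_trans isoGH (cfiso_sym isoH)).
Qed.

Lemma class_repK c : class_of (class_rep c) = c.
Proof.
rewrite class_of.unlock /class_rep -[RHS]reprK; case: (repr c) => n G.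
apply/eqmodP/asboolP.
exact: cfpull_iso (@enum_val_bij _).
Qed.

Lemma class_of_iso V (G : cfgraph V) : cfiso (class_rep (class_of G)) G.
Proof. by apply/class_ofP; rewrite class_repK. Qed.

Definition cfmul (c d : cfclass) : cfclass :=
  class_of (cfsum (class_rep c) (class_rep d)).

Definition cfone : cfclass := class_of cfempty.

Lemma cfmulE V W (G : cfgraph V) (H : cfgraph W) :
  cfmul (class_of G) (class_of H) = class_of (cfsum G H).
Proof. by apply/class_ofP/cfiso_sum; apply: class_of_iso. Qed.

Lemma cfmulC : commutative cfmul.
Proof. by move=> c d; apply/class_ofP/cfsumC. Qed.

Lemma cfmulA : associative cfmul.
Proof.
move=> b c d; rewrite -[b]class_repK -[c]class_repK -[d]class_repK !cfmulE.
exact/class_ofP/cfsumA.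
Qed.

Lemma cfmul1 : left_id cfone cfmul.
Proof. by move=> c; rewrite -[c]class_repK cfmulE; apply/class_ofP/cfsum0. Qed.

Lemma cfmul1r : right_id cfone cfmul.
Proof. by move=> c; rewrite cfmulC cfmul1. Qed.

Lemma class_of_one V (G : cfgraph V) : class_of G = cfone <-> #|V| = 0%N.
Proof.
split=> [/class_ofP [h /bij_eq_card -> _]|V0]; first exact: card_ord.
have noV (x : V) : False by have := card0_eq V0 x.
apply/class_ofP; exists (fun x => match noV x with end).
  by exists (fun x : 'I_0 => match ord0F x with end) => x;
    [case: (noV x)|case: (ord0F x)].
by split=> x; case: (noV x).
Qed.

Lemma cfmul_eq1 c d : cfmul c d = cfone -> c = cfone /\ d = cfone.
Proof.
rewrite -[c]class_repK -[d]class_repK cfmulE => /class_of_one /eqP.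
by rewrite card_sum addn_eq0 => /andP [/eqP ? /eqP ?]; split; apply/class_of_one.
Qed.

HB.instance Definition _ := Choice_isMonomialDef.Build cfclass
  cfmulA cfmul1 cfmul1r cfmul_eq1.
HB.instance Definition _ := MonomialDef_isConomialDef.Build cfclass cfmulC.

Lemma eq_set2 (T : finType) (u v x y : T) :
  ([set u; v] == [set x; y])
    = (u == x) && (v == y) || (u == y) && (v == x).
Proof.
apply/eqP/orP => [E|[] /andP [/eqP -> /eqP ->] //]; last by rewrite setUC.
move/setP: E => E; have:= E u; have:= E v; have := E x; have := E y.
rewrite !inE !eqxx !orbT /= (eq_sym y u) (eq_sym x u) (eq_sym x v) (eq_sym y v).
by case: (u == x); case: (u == y); case: (v == x); case: (v == y); auto.
Qed.

Lemma set_edgeE V (G : cfgraph V) x y c u v :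
  edge (set_edge G x y c) u v =
  if (u != v) && ((u == x) && (v == y) || (u == y) && (v == x))
  then c else edge G u v.
Proof. by rewrite mkcf_edge /set_edge_fun eq_set2. Qed.

Lemma cfsum_set_edge V W (G : cfgraph V) (H : cfgraph W) x y c :
  set_edge (cfsum G H) (inr x) (inr y) c = cfsum G (set_edge H x y c).
Proof.
apply: cfgraph_ext => [[] z|[] u [] v].
- by rewrite !mkcf_framing.
- by rewrite !mkcf_framing /= mkcf_framing.
- by rewrite set_edgeE !mkcf_edge /= !andbF.
- by rewrite set_edgeE !mkcf_edge /= ?andbF.
- by rewrite set_edgeE !mkcf_edge /= ?andbF.
- by rewrite set_edgeE !mkcf_edge /= set_edgeE !(inj_eq (@inr_inj _ _)).
Qed.

Lemma induced_set_edge V (G : cfgraph V) (p : {set V}) (x y : {x | x \in p}) c :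
  induced (set_edge G (val x) (val y) c) p = set_edge (induced G p) x y c.
Proof.
apply: cfgraph_ext => [z|u v]; first by rewrite !mkcf_framing.
by rewrite set_edgeE !mkcf_edge /set_edge_fun eq_set2 !(inj_eq val_inj).
Qed.

Lemma induced_set_edge_out V (G : cfgraph V) (p : {set V}) x y c :
  ~~ ((x \in p) && (y \in p)) -> induced (set_edge G x y c) p = induced G p.
Proof.
move=> Nxy; apply: cfgraph_ext => [z|u v]; first by rewrite !mkcf_framing.
rewrite !mkcf_edge -/(edge _ _ _) /set_edge_fun eq_set2; case: ifP => // /andP [_].
case/orP=> /andP [/eqP Ex /eqP Ey]; move: Nxy; rewrite -Ex -Ey (valP u) (valP v) //.
Qed.

Lemma no_red_set_edge V (G : cfgraph V) x y (p q : {set V}) :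
  no_red_between (set_edge G x y (Some black)) p q =
  no_red_between (set_edge G x y None) p q.
Proof.
apply: eq_forallb_in => u _; apply: eq_forallb_in => v _.
by rewrite !set_edgeE; case: ifP.
Qed.

Lemma no_red_set_edge_same V (G : cfgraph V) x y c (p : {set V}) :
  (x \in p) = (y \in p) ->
  no_red_between (set_edge G x y c) p (~: p) = no_red_between G p (~: p).
Proof.
move=> xyp; apply: eq_forallb_in => u up; apply: eq_forallb_in => v.
rewrite inE set_edgeE => vp; case: ifP => // /andP [_].
by case/orP=> /andP [/eqP Eu /eqP Ev]; move: vp up; rewrite Eu Ev xyp => /negP.
Qed.

Lemma induced_preim_iso V W (G : cfgraph V) (H : cfgraph W) (h : V -> W)
    (q : {set W}) :
  bijective h ->
  (forall x, framing H (h x) = framing G x) /\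
  (forall x y, edge H (h x) (h y) = edge G x y) ->
  cfiso (induced G (h @^-1: q)) (induced H q).
Proof.
case=> h' hK h'K [hf he].
have hin (x : {x | x \in h @^-1: q}) : h (val x) \in q.
  by have := valP x; rewrite inE.
have h'in (y : {y | y \in q}) : h' (val y) \in h @^-1: q.
  by rewrite inE h'K (valP y).
exists (fun x => exist _ (h (val x)) (hin x)).
  by exists (fun y => exist _ (h' (val y)) (h'in y)) => x;
    apply: val_inj => /=; rewrite ?hK ?h'K.
by split=> *; rewrite ?mkcf_framing ?mkcf_edge /=.
Qed.

Lemma malgUZ (K : fieldType) (T : choiceType) (a : K) (k : T) :
  a *: << k >> = << a *g k >> :> {malg K[T]}.
Proof. by apply/malgP => i; rewrite mcoeffZ !mcoeffU mulrnAr mulr1. Qed.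

HB.lock Definition basis_elt (K : fieldType) (V : finType) (G : cfgraph V) :
  {malg K[cfclass]} := << class_of G >>.

Section Bialgebra.
Variable K : fieldType.

Local Notation GC := {malg K[cfclass]}.
Local Notation basis_elt := (basis_elt K).

Lemma basis_elt_iso V W (G : cfgraph V) (H : cfgraph W) :
  cfiso G H -> basis_elt G = basis_elt H.
Proof. by rewrite basis_elt.unlock => /class_ofP ->. Qed.

Lemma basis_eltM V W (G : cfgraph V) (H : cfgraph W) :
  basis_elt G * basis_elt H = basis_elt (cfsum G H).
Proof. by rewrite basis_elt.unlock malgM_def fgmulUU mulr1 -cfmulE. Qed.

(* The coefficient of the empty graph. *)
Definition counit (g : GC) : K := g@_cfone.

(* The ordered splittings of the vertex set are the pairs (p, ~: p). *)
Definition coprod_graph V (G : cfgraph V) : tensor GC GC :=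
  \sum_(p : {set V} | no_red_between G p (~: p))
    tens (basis_elt (induced G p)) (basis_elt (induced G (~: p))).

Definition coprod : GC -> tensor GC GC :=
  linext (fun c => coprod_graph (class_rep c)).

HB.instance Definition _ := GRing.isLinear.Build K GC (tensor GC GC) _ coprod
  (linext_is_linear (fun c => coprod_graph (class_rep c))).

Inductive IC_gen : GC -> Prop :=
| ICGen V (G : cfgraph V) x y : edge G x y = Some red ->
    IC_gen (basis_elt G - basis_elt (set_edge G x y (Some black))
            + basis_elt (set_edge G x y None)).

(* The linear span of the generators is already an ideal: see IC_idealr. *)
Definition IC : {pred GC} := lspan IC_gen.

HB.instance Definition _ := GRing.SubmodClosed.on IC.
HB.instance Definition _ := GRing.ZmodClosed.on IC.

Lemma IC_gen_counit u : IC_gen u -> counit u = 0.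
Proof.
case=> V G x y _; have ne W (H : cfgraph W) (z : W) : (basis_elt H)@_cfone = 0.
  rewrite basis_elt.unlock mcoeffU; case: eqP => // /class_of_one /card0_eq.
  by move/(_ z).
have n1 := ne V G x; have n2 := ne V _ x.
by rewrite /counit mcoeffD mcoeffB n1 !n2 subrr addr0.
Qed.

Lemma counit_IC u : u \in IC -> counit u = 0.
Proof.
rewrite /counit; move: u; apply: lspan_ind => [|a v w /IC_gen_counit v0 w0].
  exact: mcoeff0.
by rewrite mcoeffD mcoeffZ w0 [_@__]v0 mulr0 addr0.
Qed.

Lemma IC_gen_mul V (G : cfgraph V) u : IC_gen u -> IC_gen (basis_elt G * u).
Proof.
case=> W H x y Hxy; rewrite mulrDr mulrBr !basis_eltM -!cfsum_set_edge.
by apply: ICGen; rewrite mkcf_edge.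
Qed.

Lemma IC_idealr : idealr_closed IC.
Proof.
split; first exact: rpred0.
  apply/negP => /counit_IC /eqP; rewrite /counit mcoeff1 eqxx oner_eq0 //.
move=> a u v Iu Iv; apply: rpredD => //.
move: u Iu; apply: lspan_ind => [|b u w Su Iaw]; first by rewrite mulr0 rpred0.
rewrite mulrDr.
apply: rpredD; last exact: Iaw.
rewrite -scalerAr.
apply: rpredZ.
rewrite [a]monalgE.
rewrite mulr_suml.
apply: rpred_sum => c _.
have -> : << a@_c *g c >> = a@_c *: basis_elt (class_rep c).
  by rewrite basis_elt.unlock class_repK -malgUZ.
rewrite -scalerAl.
apply: rpredZ.
exact/mem_lspan/IC_gen_mul.
Qed.

HB.instance Definition _ := isIdealr.Build GC IC IC_idealr.

Definition QC := {ideal_quot IC}.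

HB.instance Definition _ := GRing.ComNzRing.on QC.
HB.instance Definition _ := GRing.Lmodule.copy QC (Quotient.quot (lspan IC_gen)).

Definition projQ (g : GC) : QC := \pi g.

Lemma projQ_linear : linear projQ.
Proof. exact: quot_pi_linear. Qed.

HB.instance Definition _ := GRing.isLinear.Build K GC QC _ projQ projQ_linear.

Lemma projQ_monoid : monoid_morphism projQ.
Proof. by split=> [|x y]; rewrite /projQ ?rmorph1 ?rmorphM. Qed.

HB.instance Definition _ := GRing.isMonoidMorphism.Build GC QC projQ projQ_monoid.

Lemma projQ_eq0 g : (projQ g == 0) = (g \in IC).
Proof. by rewrite -[g in RHS]subr0 Quotient.idealrBE raddf0. Qed.

Lemma QC_scaleAl (a : K) (x y : QC) : a *: (x * y) = a *: x * y.
Proof.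
rewrite -[x]reprK -[y]reprK -!/(projQ _) -rmorphM -!linearZ -rmorphM /=.
by rewrite scalerAl.
Qed.

HB.instance Definition _ := GRing.Lmodule_isLalgebra.Build K QC QC_scaleAl.
HB.instance Definition _ := GRing.Lalgebra_isComAlgebra.Build K QC.

Lemma coprod_graph_iso V W (G : cfgraph V) (H : cfgraph W) :
  cfiso G H -> coprod_graph G = coprod_graph H.
Proof.
case=> h bij_h [hf he]; have [h' hK h'K] := bij_h.
rewrite /coprod_graph (reindex (fun q : {set W} => h @^-1: q)) /=; last first.
  exists (fun p : {set V} => h' @^-1: p) => p _; apply/setP => x;
  by rewrite !inE ?hK ?h'K.
apply: eq_big => [q|q _]; last first.
  have E (A : {set W}) : basis_elt (induced G (h @^-1: A)) = basis_elt (induced H A).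
    by apply/basis_elt_iso/induced_preim_iso.
  by rewrite -preimsetC !E.
apply/forall_inP/forall_inP => Hq x xq; apply/forall_inP => y yq.
  have := forall_inP (Hq (h' x) _) (h' y).
  by move: yq; rewrite !inE !h'K -he !h'K => yq /(_ xq) /(_ yq).
by rewrite -he; apply: (forall_inP (Hq (h x) _)); rewrite !inE in xq yq *.
Qed.

Lemma coprodE V (G : cfgraph V) : coprod (basis_elt G) = coprod_graph G.
Proof.
rewrite /coprod basis_elt.unlock linextU.
exact/coprod_graph_iso/class_of_iso.
Qed.

Lemma IC_gen_coprod u : IC_gen u -> tensor_map projQ projQ (coprod u) = 0.
Proof.
case=> V G x y Gxy; pose Gb := set_edge G x y (Some black).
pose G0 := set_edge G x y None.
pose F (H : cfgraph V) (p : {set V}) : tensor QC QC :=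
  if no_red_between H p (~: p) then
    tens (projQ (basis_elt (induced H p)))
         (projQ (basis_elt (induced H (~: p)))) else 0.
have FE H : tensor_map projQ projQ (coprod (basis_elt H)) = \sum_p F H p.
  rewrite coprodE raddf_sum -big_mkcond /=; apply: eq_bigr => p _.
  exact: tensor_mapE.
have -> : forall a b c, tensor_map projQ projQ (coprod (a - b + c)) =
    tensor_map projQ projQ (coprod a) - tensor_map projQ projQ (coprod b)
    + tensor_map projQ projQ (coprod c).
  by move=> a b c; rewrite linearD linearB linearD linearB.
rewrite (FE G) (FE Gb) (FE G0) -sumrB -big_split /=.
apply: big1 => p _.
have genQ (q : {set V}) : x \in q -> y \in q ->
    projQ (basis_elt (induced Gb q)) =
    projQ (basis_elt (induced G q)) + projQ (basis_elt (induced G0 q)).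
  move=> xq yq.
  have [x' Ex] : {x' : {x | x \in q} | val x' = x}
    by exists (exist _ x xq).
  have [y' Ey] : {y' : {x | x \in q} | val y' = y}
    by exists (exist _ y yq).
  apply/eqP; rewrite eq_sym -subr_eq0 addrAC -linearB -linearD projQ_eq0.
  rewrite /Gb /G0 -Ex -Ey !induced_set_edge; apply/mem_lspan/ICGen.
  by rewrite mkcf_edge Ex Ey.
have Fb0 : no_red_between Gb p (~: p) = no_red_between G0 p (~: p).
  exact: no_red_set_edge.
have out c (q : {set V}) : ~~ ((x \in q) && (y \in q)) ->
    induced (set_edge G x y c) q = induced G q.
  exact: induced_set_edge_out.
rewrite /F Fb0; case: (boolP ((x \in p) == (y \in p))) => [/eqP|] xyp.
  rewrite !(no_red_set_edge_same _ _ xyp).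
  case: ifP => _; last by rewrite subrr addr0.
  case xp : (x \in p).
    have yp : y \in p by rewrite -xyp.
    rewrite (genQ p xp yp) !(out _ (~: p)) ?inE ?xp // tensDl1.
    by rewrite opprD addrA subrr sub0r addNr.
  have yp : y \in p = false by rewrite -xyp.
  rewrite (genQ (~: p)) ?inE ?xp ?yp // !(out _ p) ?inE ?xp // tensDr1.
  by rewrite opprD addrA subrr sub0r addNr.
have -> : no_red_between G p (~: p) = false.
  apply/negP => /forall_inP NR; move: xyp.
  case xp : (x \in p); case yp : (y \in p) => // _.
    by have /forall_inP /(_ y) := NR x xp; rewrite inE yp Gxy => /(_ isT).
  by have /forall_inP /(_ x) := NR y yp; rewrite inE xp edge_sym Gxy => /(_ isT).
rewrite sub0r !out ?inE; last 4 first.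
- by move: xyp; case: (x \in p); case: (y \in p).
- by move: xyp; case: (x \in p); case: (y \in p).
- by move: xyp; case: (x \in p); case: (y \in p).
- by move: xyp; case: (x \in p); case: (y \in p).
by rewrite addNr.
Qed.

(* Independent of the representative, as IC is a coideal: see coprodQE. *)
Definition coprodQ (q : QC) : tensor QC QC :=
  tensor_map projQ projQ (coprod (repr q)).

Lemma coprodQE g : coprodQ (projQ g) = tensor_map projQ projQ (coprod g).
Proof.
apply/eqP; rewrite /coprodQ -subr_eq0 -!linearB /=; apply/eqP.
have : repr (projQ g) - g \in IC by rewrite Quotient.idealrBE reprK.
move: (_ - g) => u; move: u; apply: lspan_ind => [|a u v Su IH].
  by rewrite !linear0.
by rewrite !linearP /= IH addr0 IC_gen_coprod // scaler0.
Qed.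

Lemma coprodQ_is_linear : linear coprodQ.
Proof.
move=> a x y; rewrite -[x]reprK -[y]reprK -!/(projQ _) -linearP !coprodQE.
by rewrite !linearP.
Qed.

HB.instance Definition _ :=
  GRing.isLinear.Build K QC (tensor QC QC) _ coprodQ coprodQ_is_linear.

Definition counitQ (q : QC) : K := counit (repr q).

Lemma counitQE g : counitQ (projQ g) = counit g.
Proof.
have : repr (projQ g) - g \in IC by rewrite Quotient.idealrBE reprK.
by move/counit_IC/eqP; rewrite /counitQ /counit mcoeffB subr_eq0 => /eqP.
Qed.

Definition primitive (q : QC) : Prop := coprodQ q = tens q 1 + tens 1 q.

Definition red_connected_class (q : QC) : Prop :=
  exists (V : finType) (G : cfgraph V),
    [/\ cfconnected G, all_red G & q = projQ (basis_elt G)].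

End Bialgebra.

(* Main.v *)
From HB Require Import structures.
Require Import Defs.
From mathcomp Require Import all_boot all_algebra generic_quotient.
From mathcomp Require Import boolp monalg.
Set Implicit Arguments.
Unset Strict Implicit.
Unset Printing Implicit Defensive.

Import GRing.Theory.
Local Open Scope ring_scope.
Local Open Scope quotient_scope.

(** Write [mu] for the multiplication [x (x) y |-> x * y] and consider the
    linear endomorphism [Psi = mu o Delta] of the quotient bialgebra.

    A primitive [q] satisfies [Psi q = q * 1 + 1 * q = 2 q], so primitives are
    eigenvectors of [Psi] for the eigenvalue 2.  A graph [G] all of whose edges
    are red is an eigenvector as well: an ordered splitting of its vertices
    that cuts no red edge cuts no edge at all, hence the product of its two
    parts is [G] again, and [Psi G = N G], with [N] the number of such
    splittings ([copower_red]).  Here [N = 2] exactly when [G] is connected,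
    the two splittings being those with an empty part ([connectedP_cuts]).

    The relation [G_b = G_r + G_0] removes black edges one at a time, so the
    red graphs span the quotient ([red_span]).  A primitive is thus a
    combination of eigenvectors of [Psi] and is itself an eigenvector for the
    eigenvalue 2; only the terms with eigenvalue 2 can contribute
    ([eigen_lspan]).  In characteristic 0 these are the terms with [N = 2],
    the connected red graphs.

    Conversely, a connected red graph has just the two trivial splittings,
    which says that it is primitive ([red_connected_primitive]). *)

Lemma pchar0_natr_inj (K : fieldType) :
  [pchar K] =i pred0 -> injective (fun n : nat => n%:R : K).
Proof.
move=> /pcharf0P charK0 m n; wlog le_mn : m n / (m <= n)%N => [IH|] mn.
  by case/orP: (leq_total m n) => /IH; [apply | move=> ->].
apply/anti_leq; rewrite le_mn -subn_eq0 -charK0 natrB //.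
by rewrite -mn subrr eqxx.
Qed.

(** * Eigenvectors in the span of eigenvectors *)

Section Eigen.
Variables (K : fieldType) (V : lmodType K) (f : {linear V -> V}) (mu : K).

(** The polynomial with roots [L] and value 1 at [mu], evaluated at [f]: when
    [mu] is not in [L], it fixes the eigenvectors for [mu] and kills those for
    the elements of [L]. *)
Definition eigen_filter (L : seq K) (v : V) : V :=
  foldr (fun l w => (mu - l)^-1 *: (f w - l *: w)) v L.

Lemma eigen_filter_linear (L : seq K) : linear (eigen_filter L).
Proof.
elim: L => [|l L IH] a x y //=; rewrite IH linearP [l *: (_ + _)]scalerDr.
rewrite opprD addrACA scalerDr; congr (_ + _).
by rewrite [l *: _]scalerA [l * a]mulrC -scalerA -scalerBr !scalerA mulrC.
Qed.

HB.instance Definition _ L :=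
  GRing.isLinear.Build K V V _ (eigen_filter L) (eigen_filter_linear L).

Lemma eigen_filterE (L : seq K) (l : K) (v : V) : f v = l *: v ->
  eigen_filter L v = (\prod_(k <- L) ((mu - k)^-1 * (l - k))) *: v.
Proof.
move=> fv; elim: L => [|k L IH] /=; first by rewrite big_nil scale1r.
by rewrite IH linearZ /= fv big_cons !scalerA -scalerBl scalerA -mulrA mulrBl
  [_ * l]mulrC.
Qed.

(** If [v] is a combination of eigenvectors, applying to [v] the filter of all
    eigenvalues other than [mu] that occur does not change [v], while it leaves
    only the terms for [mu] in the combination. *)
Lemma eigen_lspan (S : V -> Prop) (v : V) :
  (forall s, S s -> exists l, f s = l *: s) -> f v = mu *: v ->
  v \in lspan S -> v \in lspan (fun s => S s /\ f s = mu *: s).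
Proof.
move=> eigS fv /asboolP [n [a [u [Su Dv]]]].
have /fin_all_exists [l fu] i := eigS _ (Su i).
pose L := [seq x <- [seq l i | i <- enum 'I_n] | x != mu].
have -> : v = eigen_filter L v.
  rewrite (eigen_filterE _ fv) big1_seq ?scale1r // => k /andP [_].
  by rewrite mem_filter eq_sym -subr_eq0 => /andP [k_mu _]; rewrite mulVf.
rewrite Dv linear_sum rpred_sum // => i _ /=; rewrite linearZ rpredZ //=.
have [l_mu | l_mu] := eqVneq (l i) mu.
  rewrite (eigen_filterE _ (fu i)) rpredZ // mem_lspan //.
  by split; [exact: Su | rewrite fu l_mu].
have Ll : l i \in L by rewrite mem_filter l_mu map_f ?mem_enum.
by rewrite (eigen_filterE _ (fu i)) (big_rem _ Ll) /= subrr mulr0 mul0r scale0r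
  rpred0.
Qed.

End Eigen.

(** * Multiplication on the tensor square *)

Section TensorMul.
Variables (K : fieldType) (A : algType K).

Definition tensor_mul (t : tensor A A) : A :=
  linext (fun p => p.1 * p.2) (repr t).

(** Well-definedness: the bilinearity of the product kills the relations that
    define the tensor product, so any representative may be used. *)
Lemma tensor_mul_pi (x : {malg K[(A * A)%type]}) :
  tensor_mul (\pi x) = linext (fun p => p.1 * p.2) x.
Proof.
apply/eqP; rewrite -subr_eq0 -linearB /=; apply/eqP.
have : repr (\pi_(tensor A A) x) - x \in lspan (@bilin_rel K A A).
  by rewrite Quotient.idealrBE reprK.
move: (_ - x) => {x}; apply: lspan_ind => [|a u w Su IH]; first by rewrite linear0.
rewrite linearP /= IH addr0 -[RHS](scaler0 _ a); congr (_ *: _).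
by case: Su => *; rewrite !linearB linearZ /= !linextU /= (mulrDl, mulrDr)
  -?scalerAl -?scalerAr -addrA -opprD subrr.
Qed.

Lemma tensor_mul_linear : linear tensor_mul.
Proof.
move=> a x y; rewrite -[x]reprK -[y]reprK -quot_pi_linear !tensor_mul_pi.
exact: linearP.
Qed.

HB.instance Definition _ :=
  GRing.isLinear.Build K (tensor A A) A _ tensor_mul tensor_mul_linear.

Lemma tensor_mulE (x y : A) : tensor_mul (tens x y) = x * y.
Proof. by rewrite tens.unlock tensor_mul_pi linextU. Qed.

End TensorMul.

(** * Splittings of a graph without black edges *)

Section Cuts.
Variables (V : finType) (G : cfgraph V).

Definition red_cuts : {set {set V}} := [set p | no_red_between G p (~: p)].

Lemma red_cuts0 : set0 \in red_cuts.
Proof. by rewrite inE; apply/forall_inP => x; rewrite inE. Qed.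

Lemma red_cutsT : setT \in red_cuts.
Proof.
by rewrite inE; apply/forall_inP => x _; apply/forall_inP => y; rewrite !inE.
Qed.

Hypothesis redG : all_red G.

Lemma all_red_edge x y : edge G x y != Some red -> edge G x y = None.
Proof.
have /forallP /(_ x) /forallP /(_ y) := redG.
by case: (edge G x y) => // -[].
Qed.

Lemma red_cut_edge p x y :
  p \in red_cuts -> x \in p -> y \notin p -> edge G x y = None.
Proof.
rewrite inE => /forall_inP cut_p xp yp; apply: all_red_edge.
by apply: (forall_inP (cut_p x xp)); rewrite inE.
Qed.

Lemma red_cut_closed p : p \in red_cuts -> closed (adjacent G) p.
Proof.
move=> cut_p; apply: intro_closed => [|x y].
  by apply: sym_connect_sym => x y; rewrite /adjacent edge_sym.
rewrite /adjacent => adj xp; apply: contraNT adj => yp.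
by rewrite (red_cut_edge cut_p xp yp).
Qed.

(** A disconnected graph has, besides the two trivial splittings, one that
    separates the component of a vertex from the rest. *)
Lemma connectedP_cuts : reflect (#|red_cuts| = 2)%N (cfconnected G).
Proof.
apply: (iffP andP) => [[V_gt0 /forallP conG]|cuts2].
  have [x _] := card_gt0P V_gt0.
  have -> : red_cuts = [set set0; setT].
    apply/setP => p; rewrite !inE; apply/idP/orP => [cut_p|]; last first.
      by case=> /eqP ->; [have := red_cuts0 | have := red_cutsT]; rewrite inE.
    have clp : closed (adjacent G) p by apply: red_cut_closed; rewrite inE.
    have memp y : (y \in p) = (x \in p).
      by apply/esym/(closed_connect clp); have /forallP := conG x; apply.
    by case xp: (x \in p); [right | left]; apply/eqP/setP => y;
      rewrite memp xp !inE.
  by rewrite cards2 eq_sym -card_gt0 cardsT V_gt0.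
have V_gt0 : (0 < #|V|)%N.
  rewrite lt0n; apply/negP => /eqP /card0_eq V0.
  have : red_cuts \subset [set set0].
    by apply/subsetP => p _; rewrite inE; apply/eqP/setP => x; have := V0 x.
  by move/subset_leq_card; rewrite cards1 cuts2.
split=> //; apply/forallP => x; apply/forallP => y; apply/negPn/negP => Nxy.
pose p := [set z | connect (adjacent G) x z].
have cut_p : p \in red_cuts.
  rewrite inE; apply/forall_inP => u; rewrite inE => xu.
  apply/forall_inP => v; rewrite !inE; apply: contraNN => /eqP uv.
  by apply: (connect_trans xu); apply: connect1; rewrite /adjacent uv.
have xp : x \in p by rewrite inE connect0.
have yp : y \notin p by rewrite inE.
have : [set set0; setT; p] \subset red_cuts.
  by rewrite !subUset !sub1set red_cuts0 red_cutsT cut_p.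
move/subset_leq_card; rewrite cuts2 setUC cardsU1 cards2 !inE.
rewrite [set0 == _]eq_sym -card_gt0 cardsT V_gt0.
have -> : p == set0 = false by apply: contraTF xp => /eqP ->; rewrite inE.
by have -> : p == setT = false by apply: contraNF yp => /eqP ->; rewrite inE.
Qed.

(** With only red edges present, a splitting that cuts no red edge is a union
    of components against its complement, so gluing the parts gives [G] back. *)
Lemma red_cut_iso p : p \in red_cuts ->
  cfiso (cfsum (induced G p) (induced G (~: p))) G.
Proof.
move=> cut_p.
have cutE x y : x \in p -> y \in ~: p -> edge G x y = None.
  by rewrite inE; apply: red_cut_edge.
have disj (x : {x | x \in p}) (y : {y | y \in ~: p}) : val x <> val y.
  by move=> xy; have := valP y; rewrite /= -xy inE (valP x).
exists (fun z => match z with inl x => val x | inr y => val y end).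
  apply: inj_card_bij; last by rewrite card_sum !card_sig cardsC.
  case=> x [] y /=.
  - by move/val_inj => ->.
  - by move/disj.
  - by move/esym/disj.
  - by move/val_inj => ->.
split=> [[] x|[] x [] y]; rewrite ?mkcf_framing ?mkcf_edge /= ?mkcf_framing
  ?mkcf_edge //; last rewrite edge_sym; exact: cutE (valP _) (valP _).
Qed.

End Cuts.

(** * The convolution square of the identity *)

Section Copower.
Variable K : fieldType.

Definition red_class (q : QC K) : Prop :=
  exists (V : finType) (G : cfgraph V), all_red G /\ q = projQ (basis_elt K G).

(** The second Adams operation, i.e. the convolution square of the identity. *)
Definition copower (q : QC K) : QC K := tensor_mul (coprodQ q).

HB.instance Definition _ := GRing.Linear.copy copower
  (@tensor_mul K (QC K) \o @coprodQ K).

Lemma red_cut_mul (V : finType) (G : cfgraph V) (p : {set V}) :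
  all_red G -> p \in red_cuts G ->
  projQ (basis_elt K (induced G p)) * projQ (basis_elt K (induced G (~: p)))
    = projQ (basis_elt K G).
Proof.
move=> redG cut_p; rewrite -rmorphM basis_eltM.
by rewrite (basis_elt_iso K (red_cut_iso redG cut_p)).
Qed.

Lemma coprodQ_basis (V : finType) (G : cfgraph V) :
  coprodQ (projQ (basis_elt K G)) =
  \sum_(p in red_cuts G) tens (projQ (basis_elt K (induced G p)))
                              (projQ (basis_elt K (induced G (~: p)))).
Proof.
rewrite coprodQE coprodE linear_sum; apply: eq_big => [p|p _].
  by rewrite inE.
exact: tensor_mapE.
Qed.

(** Each admissible splitting contributes one copy of [G] itself, since its two
    parts multiply to [G]. *)
Lemma copower_red (V : finType) (G : cfgraph V) : all_red G ->
  copower (projQ (basis_elt K G)) = #|red_cuts G|%:R *: projQ (basis_elt K G).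
Proof.
move=> redG; rewrite /copower coprodQ_basis linear_sum scaler_nat -sumr_const.
by apply: eq_bigr => p cut_p; rewrite /= tensor_mulE red_cut_mul.
Qed.

Lemma copower_primitive (q : QC K) : primitive q -> copower q = 2 *: q.
Proof.
rewrite /primitive /copower => ->.
by rewrite linearD /= !tensor_mulE mulr1 mul1r scaler_nat mulr2n.
Qed.

(** Induction on the number of black edges: modulo the ideal, a graph with a
    black edge is the sum of the graph with that edge red and the graph without
    it, and both have fewer black edges. *)
Lemma red_span (q : QC K) : q \in lspan red_class.
Proof.
have graph_span (V : finType) (G : cfgraph V) :
    projQ (basis_elt K G) \in lspan red_class.
  pose blacks (H : cfgraph V) :=
    [set e : V * V | edge H e.1 e.2 == Some black].
  have [n] := ubnP #|blacks G|; elim: n => // n IH in G *; rewrite ltnS => Gn.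
  case: (boolP (all_red G)) => [redG|]; first by apply: mem_lspan; exists V, G.
  case/forallPn => x /forallPn [y /negPn /eqP Gxy].
  have x_y : x != y by apply/eqP => xy; rewrite xy edge_irr in Gxy.
  have fewer c : c != Some black -> (#|blacks (set_edge G x y c)| < n)%N.
    move=> Nc; apply: leq_trans Gn; apply/proper_card/properP; split.
      apply/subsetP => -[u v]; rewrite !inE /= set_edgeE.
      by case: ifP => // _ /eqP E; rewrite E in Nc.
    by exists (x, y); rewrite !inE /= ?Gxy // set_edgeE x_y !eqxx.
  pose Gr := set_edge G x y (Some red).
  have Grxy : edge Gr x y = Some red by rewrite set_edgeE x_y !eqxx.
  (* G is recovered from its red recoloring as the black graph of a
     generator of the ideal. *)
  have reset c : set_edge Gr x y c = set_edge G x y c.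
    apply: cfgraph_ext => [u|u v]; first by rewrite !mkcf_framing.
    by rewrite /Gr !set_edgeE; case: (_ && _).
  have resetG : set_edge G x y (Some black) = G.
    apply: cfgraph_ext => [u|u v]; first by rewrite mkcf_framing.
    rewrite set_edgeE; case: ifP => // /andP [_].
    by case/orP=> /andP [/eqP -> /eqP ->] //; rewrite edge_sym.
  have := mem_lspan (ICGen K Grxy); rewrite !reset resetG.
  rewrite -[_ \in _]/(_ \in @IC K) -projQ_eq0 linearD linearB /= addrAC subr_eq0.
  by move/eqP <-; apply: rpredD; apply: IH; apply: fewer.
rewrite -[q]reprK -[\pi _]/(projQ (repr q)) [repr q]monalgE linear_sum.
apply: rpred_sum => c _; rewrite -malgUZ linearZ /= rpredZ //.
by have := graph_span _ (class_rep c); rewrite basis_elt.unlock class_repK.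
Qed.

Lemma basis_elt0 (V : finType) (G : cfgraph V) : #|V| = 0%N -> basis_elt K G = 1.
Proof. by rewrite basis_elt.unlock => /class_of_one ->. Qed.

(** In the two remaining splittings one part is empty, hence has class 1, and
    [red_cut_mul] then identifies the other part with the whole graph. *)
Lemma red_connected_primitive (q : QC K) : red_connected_class q -> primitive q.
Proof.
case=> V [G [conG redG ->]].
have /(connectedP_cuts redG) cuts2 := conG.
have V_gt0 : (0 < #|V|)%N by case/andP: conG.
have cuts : red_cuts G = [set setT; set0].
  apply/esym/eqP; rewrite eqEcard cuts2 cards2 -card_gt0 cardsT V_gt0 andbT.
  by rewrite subUset !sub1set red_cuts0 red_cutsT.
have ind0 (p : {set V}) : p = set0 -> projQ (basis_elt K (induced G p)) = 1.
  by move=> ->; rewrite basis_elt0 ?rmorph1 // card_sig cards0.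
rewrite /primitive coprodQ_basis cuts big_setU1 ?big_set1 /=; last first.
  by rewrite inE -card_gt0 cardsT V_gt0.
have := red_cut_mul redG (red_cutsT G).
have := red_cut_mul redG (red_cuts0 G).
by rewrite (ind0 set0) // (ind0 (~: setT)) ?setCT // mul1r mulr1 => -> ->.
Qed.

Lemma primitive_lspan (S : QC K -> Prop) (q : QC K) :
  (forall s, S s -> primitive s) -> q \in lspan S -> primitive q.
Proof.
move=> primS; move: q; apply: lspan_ind => [|a v w /primS pv pw].
  have tens0l w : tens 0 w = 0 :> tensor (QC K) (QC K).
    by apply: (addrI (tens 0 w)); rewrite -tensDl1 !addr0.
  have tens0r w : tens w 0 = 0 :> tensor (QC K) (QC K).
    by apply: (addrI (tens w 0)); rewrite -tensDr1 !addr0.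
  by rewrite /primitive linear0 tens0l tens0r addr0.
rewrite /primitive linearP /= pv pw tensDl tensDr scalerDr.
exact: addrACA.
Qed.

End Copower.

Theorem proposition1p2 (K : fieldType) (charK0 : [pchar K] =i pred0) (q : QC K) :
  primitive q <-> q \in lspan (@red_connected_class K).
Proof.
split; last exact/primitive_lspan/red_connected_primitive.
move=> /copower_primitive eig_q.
have eig_red (s : QC K) : red_class s -> exists l, copower s = l *: s.
  by case=> V [G [redG ->]]; exists #|red_cuts G|%:R; apply: copower_red.
have := eigen_lspan eig_red eig_q (red_span q).
apply: lspan_sub => s [[V [G [redG ->]]]]; rewrite /= copower_red // => /eqP.
rewrite -subr_eq0 -scalerBl scaler_eq0 => /orP [|/eqP ->]; last exact: rpred0.
move=> cuts2; apply: mem_lspan; exists V, G; split=> //.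
apply/(connectedP_cuts redG)/(pchar0_natr_inj charK0)/eqP.
by rewrite -subr_eq0.
Qed.
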